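(* Let $\kappa$ be a regular uncountable cardinal and let $\chi,\theta<\kappa$ be infinite cardinals. If either of the following two hypotheses holds, then $\mathrm{U}(\kappa,\kappa,\theta,\chi)$ holds: (1) $\square(\kappa)$ holds; or (2) there exists a non-reflecting stationary subset of $E^\kappa_{\geq\chi}$. In particular, if $\theta\leq\lambda$ are infinite regular cardinals, then $\mathrm{U}(\lambda^+,\lambda^+,\theta,\lambda)$ holds.
   Context: For a set $X$ and a cardinal $\nu$, $[X]^\nu$ is the set of subsets of $X$ of size $\nu$. For sets of ordinals $a,b$, $a<b$ means $\alpha<\beta$ for all $\alpha\in a,\beta\in b$. For a collection $\mathcal B$ of sets of ordinals, $(a,b)\in[\mathcal B]^2$ means that $a,b$ are distinct elements of $\mathcal B$ with $a<b$. For $c:[\kappa]^2\to\theta$ and $\alpha<\beta<\kappa$, $c(\alpha,\beta)$ denotes $c(\{\alpha,\beta\})$, and for $a<b$, $c[a\times b]=\{c(\alpha,\beta)\mid\alpha\in a,\beta\in b\}$. For a regular uncountable cardinal $\kappa$ and cardinals $\mu,\theta,\chi\le\kappa$, $\mathrm{U}(\kappa,\mu,\theta,\chi)$ asserts the existence of a coloring $c:[\kappa]^2\to\theta$ such that for every $\chi'<\chi$, every family $\mathcal A\subseteq[\kappa]^{\chi'}$ consisting of $\kappa$-many pairwise disjoint sets, and every $i<\theta$, there exists $\mathcal B\in[\mathcal A]^\mu$ such that $\min(c[a\times b])>i$ for all $(a,b)\in[\mathcal B]^2$. $E^\kappa_{\ge\chi}=\{\alpha<\kappa\mid \mathrm{cf}(\alpha)\ge\chi\}$.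 A set $S\subseteq\kappa$ is non-reflecting if there is no $\alpha<\kappa$ with $\mathrm{cf}(\alpha)>\omega$ such that $S\cap\alpha$ is stationary in $\alpha$. $\square(\kappa)$ is the standard principle: there is a sequence $\langle C_\alpha\mid\alpha<\kappa \text{ limit}\rangle$ such that each $C_\alpha$ is a club in $\alpha$, $C_{\bar\alpha}=C_\alpha\cap\bar\alpha$ whenever $\bar\alpha<\alpha$ is an accumulation point of $C_\alpha$, and there is no club $D\subseteq\kappa$ such that $D\cap\alpha=C_\alpha$ for every accumulation point $\alpha<\kappa$ of $D$. *)

(* Defs.v *)
From mathcomp Require Import all_boot all_order.
From mathcomp Require Import boolp classical_sets functions cardinality.

Set Implicit Arguments.
Unset Strict Implicit.
Unset Printing Implicit Defensive.

Local Open Scope classical_set_scope.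
Local Open Scope card_scope.
Local Open Scope order_scope.

(* Ordinals are the elements of a well-founded total order [O]; an ordinal is
   identified with the set [below a] of its predecessors.  Since [O] is
   arbitrary, every ordinal is represented in some such [O].  Well-foundedness
   is not bundled: it has to be assumed by the statements. *)

Section Ordinals.
Context {d : Order.disp_t} {O : orderType d}.
Implicit Types (a b g k l mu theta chi : O) (C D S X : set O).

Definition ord_wf := well_founded (fun a b : O => a < b).

Definition below a : set O := [set x | x < a].

(* The minimum of [X], with default value [x0] when [X] is empty. *)
Definition ordmin (x0 : O) X : O := xget x0 (X `&` lbound X).

Definition is_limit a :=
  (exists b, b < a) /\ forall b, b < a -> exists g, b < g < a.

Definition is_omega a :=
  infinite_set (below a) /\ forall b, b < a -> finite_set (below b).

Definition is_cardinal a := forall b, b < a -> ~ (below b #= below a).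

Definition infinite_cardinal a := is_cardinal a /\ infinite_set (below a).

(* The set always contains [a], so the default value is never used. *)
Definition cf a : O :=
  ordmin a [set g | exists f : O -> O,
    (forall x, x < g -> f x < a) /\
    (forall y, y < a -> exists2 x, x < g & y <= f x)].

Definition uncountable_cf a := exists2 w, is_omega w & w < cf a.

Definition regular_cardinal k := infinite_cardinal k /\ cf k = k.

Definition regular_uncountable k :=
  regular_cardinal k /\ ~ countable (below k).

Definition is_successor_cardinal l k :=
  [/\ is_cardinal k, l < k & forall b, l < b -> b < k -> ~ is_cardinal b].

(* sup (X `&` below a) = a > 0. *)
Definition acc_point X a :=
  (exists b, b < a) /\ forall b, b < a -> exists2 x, X x & b < x < a.

Definition unbounded_in a X :=
  forall b, b < a -> exists2 x, X x & b < x < a.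

Definition club_in a C :=
  [/\ C `<=` below a, unbounded_in a C &
      forall b, b < a -> acc_point C b -> C b].

Definition stationary_in a S :=
  S `<=` below a /\ forall C, club_in a C -> S `&` C !=set0.

Definition cof_ge k chi : set O := [set a | a < k /\ chi <= cf a].

Definition nonreflecting k S :=
  ~ exists a, [/\ a < k, uncountable_cf a & stationary_in a (S `&` below a)].

Definition square k := exists C : O -> set O,
  [/\ forall a, a < k -> is_limit a -> club_in a (C a),
      forall a b, a < k -> is_limit a -> b < a -> acc_point (C a) b ->
        C b = (C a `&` below b)%classic &
      ~ exists D, club_in k D /\
          forall a, a < k -> acc_point D a -> (D `&` below a)%classic = C a].

(* [X]^nu *)
Definition subsets_of_size {T : Type} (X : set T) (nu : O) : set (set T) :=
  [set Y | Y `<=` X /\ Y #= below nu].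

Definition set_lt (X Y : set O) := forall x y, X x -> Y y -> x < y.

(* A colouring of unordered pairs is given by a binary function, of which only
   the values [c x y] with [x < y] matter. *)
Definition colouring k theta (c : O -> O -> O) :=
  forall x y, x < y -> y < k -> c x y < theta.

(* The principle U(k, mu, theta, chi).  The images [c[s x t]] below are nonempty,
   as pairwise disjoint families of size [k] only exist for [chi' > 0], so the
   default value of [ordmin] is never used. *)
Definition U k mu theta chi := exists2 c : O -> O -> O, colouring k theta c &
  forall chi', chi' < chi -> is_cardinal chi' ->
  forall A : set (set O), A `<=` subsets_of_size (below k) chi' ->
    A #= below k -> trivIset A id ->
  forall i, i < theta ->
  exists2 B, subsets_of_size A mu B &
    forall s t, B s -> B t -> s <> t -> set_lt s t ->
      i < ordmin i [set c x y | x in s & y in t].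

End Ordinals.

Arguments ord_wf {d} O.

(* Main.v *)
(* Let [C] be a ladder system on [kappa] and let [c a b] be the maximum of [h]
   over the walk from [b] down to [a].  If [C] is coherent at [dl] whenever [dl]
   is an accumulation point of a ladder, and [h b] only depends on the first
   element [>= xi] of [C b], then for all [b > dl] there is [l < dl] with
   [h dl <= c a b] for every [a] in the interval [(l, dl)]: the walk from [b] to
   [a] passes through [dl] or through some [b'] having [dl] as an accumulation
   point of [C b'], and in the latter case [h b' = h dl].  When [cf dl] exceeds
   the size of the members of the given family [A], the same [l] serves a whole
   member of [A] lying above [dl].  Fodor's lemma makes [l] constant on a
   stationary set of [dl]'s with [h dl] a prescribed value [> i], and thinning
   out by a club yields the subfamily.

   That [h] can be chosen to take every value below [theta] on stationarily many
   [dl] of large cofinality is a Solovay-style argument: otherwise there would be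
   a club [D] such that, for all [g < a] in [D] of large cofinality, [g] is an
   accumulation point of [C a], which threads a square sequence, and is absurd if
   the ladders avoid the non-reflecting stationary set under consideration. *)

Require Import Defs.
From mathcomp Require Import all_boot all_order finmap.
From mathcomp Require Import boolp classical_sets functions cardinality.

Set Implicit Arguments.
Unset Strict Implicit.

Import Order.TTheory.

Local Open Scope classical_set_scope.
Local Open Scope card_scope.
Local Open Scope order_scope.

(** * Choice, well-founded recursion and comparison of cardinalities *)

Lemma choice_on {T U : Type} (u0 : U) (P : T -> Prop) (Q : T -> U -> Prop) :
  (forall x, P x -> exists y, Q x y) -> exists f, forall x, P x -> Q x (f x).
Proof.
move=> PQ; have /choice[f fP] : forall x, exists y, P x -> Q x y.
  by move=> x; have [/PQ[y Qy]|nP] := EM (P x); [exists y|exists u0].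
by exists f.
Qed.

(** The guard returns [u0] off [R], so a recursive definition satisfies a plain equation, free of
    accessibility proofs. *)
Lemma wf_rec {T U : Type} {R : T -> T -> Prop} (wfR : well_founded R) (u0 : U)
    (F : T -> (T -> U) -> U) :
  exists f, forall a, f a = F a (fun b => if `[< R b a >] then f b else u0).
Proof.
pose G a (rec : forall b, R b a -> U) := F a (fun b =>
  match pselect (R b a) with left h => rec b h | right _ => u0 end).
exists (Fix wfR (fun=> U) G) => a; rewrite Fix_eq.
  rewrite /G; congr (F a); apply/funext => b.
  by case: pselect => h; case: asboolP.
move=> x f g fg; rewrite /G; congr (F x); apply/funext => b.
by case: pselect.
Qed.

Lemma card_le_inj {T U : Type} {A : set T} {B : set U} (f : T -> U) :
  (forall x, A x -> B (f x)) ->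
  (forall x y, A x -> A y -> f x = f y -> x = y) -> A #<= B.
Proof.
move=> fB finj; have /inj_card_eq fA : {in A &, injective f}.
  by move=> x y /set_mem Ax /set_mem Ay; exact: finj.
rewrite -(card_le_eql fA); apply: subset_card_le => _ [x Ax <-]; exact: fB.
Qed.

Lemma card_le_surj {T U : Type} {A : set T} {B : set U} (f : U -> T) :
  (forall x, A x -> exists2 y, B y & f y = x) -> A #<= B.
Proof.
move=> Af; apply: card_le_trans (card_image_le f B).
by apply: subset_card_le => x /Af[y By <-]; exists y.
Qed.

Lemma card_leE {T U : Type} (u0 : U) {A : set T} {B : set U} : A #<= B ->
  exists2 f : T -> U, forall x, A x -> B (f x) &
    forall x y, A x -> A y -> f x = f y -> x = y.
Proof.
elim/Ppointed: U => U in u0 B *; first by case: (no u0).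
move=> /pcard_leP /injfunPex[f fB finj]; exists f => // x y Ax Ay.
by apply: finj; rewrite inE.
Qed.

Lemma card_leE_surj {T U : Type} (t0 : T) {A : set T} {B : set U} : A #<= B ->
  exists f : U -> T, forall x, A x -> exists2 y, B y & f y = x.
Proof.
elim/Ppointed: T => T in t0 A *; first by case: (no t0).
by move=> /pcard_surjP[f fB]; exists f => x /fB[y By <-]; exists y.
Qed.

(** Hilbert's hotel: along an injective sequence [e] in [X], a new point [b] moves to [e 0], each
    [e n] moves to [e n.+1], and everything else stays put. *)
Lemma infinite_card_setU1 {T : Type} (X : set T) (b : T) :
  infinite_set X -> (X `|` [set b]) #<= X.
Proof.
move=> /infiniteP/(card_leE b)[e eX einj].
have [Xb|Xb] := EM (X b); first by apply: subset_card_le => x [|->].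
pose h x := if pselect (x = b) is left _ then e 0%N else
  if pselect (exists n, x = e n) is left ex then e (xget 0%N [set n | x = e n]).+1
  else x.
have he n : h (e n) = e n.+1.
  rewrite /h; case: pselect => [eb|_]; first by case: Xb; rewrite -eb; exact: eX.
  case: pselect => [[m em]|[]]; last by exists n.
  have /= /einj := xgetI 0%N (P := [set k | e n = e k]) (erefl (e n)).
  by move=> <-.
have hb : h b = e 0%N by rewrite /h; case: pselect.
have hid x : x <> b -> (forall n, x <> e n) -> h x = x.
  by move=> xb xe; rewrite /h; case: pselect => // _; case: pselect => // -[n /xe].
have cases x : (X `|` [set b]) x ->
    [\/ x = b, exists n, x = e n | [/\ X x, x <> b & forall n, x <> e n]].
  have [->|nxb] := EM (x = b); first by constructor 1.
  have [xe|nxe] := EM (exists n, x = e n); first by constructor 2.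
  by case=> // Xx; constructor 3; split=> // n xe; apply: nxe; exists n.
apply: (card_le_inj (f := h)) => [x|x y].
  by case/cases => [->|[n ->]|[Xx xb xe]]; rewrite ?hb ?he ?hid //; exact: eX.
case/cases => [->|[n ->]|[Xx xb xe]]; case/cases => [->|[m ->]|[Xy yb ye]];
  rewrite ?hb ?he ?(hid x) ?(hid y) //.
- by move=> /einj-/(_ I I).
- by move=> /esym/ye.
- by move=> /einj-/(_ I I).
- by move=> /einj-/(_ I I)[->].
- by move=> /esym/ye.
- by move=> /xe.
- by move=> /xe.
Qed.

(** * Minima, cofinality and limits in a well-order *)

Section WellOrder.
Context {d : Order.disp_t} {O : orderType d} (wfO : ord_wf O).
Implicit Types (a b g k l : O) (X Y C D S : set O).

Lemma ord_ind (P : O -> Prop) :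
  (forall a, (forall b, b < a -> P b) -> P a) -> forall a, P a.
Proof. exact: (well_founded_ind wfO). Qed.

Lemma ex_min X : X !=set0 -> exists2 m, X m & forall x, X x -> m <= x.
Proof.
case=> a; elim/ord_ind: a => a IH Xa.
have [[b [Xb ba]]|nb] := EM (exists b, X b /\ b < a); first exact: IH ba Xb.
by exists a => // x Xx; rewrite leNgt; apply/negP => xa; apply: nb; exists x.
Qed.

Lemma ordminP x0 X : X !=set0 ->
  X (ordmin x0 X) /\ forall x, X x -> ordmin x0 X <= x.
Proof.
move=> /ex_min[m Xm mlb]; rewrite /ordmin; case: xgetP => [_ _ []|/(_ m)] //.
by case.
Qed.

Lemma cf_set0 a : [set g | exists f : O -> O,
    (forall x, x < g -> f x < a) /\
    (forall y, y < a -> exists2 x, x < g & y <= f x)] !=set0.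
Proof. by exists a, id; split=> // y ya; exists y. Qed.

Lemma cf_fun a : exists f : O -> O,
  (forall x, x < cf a -> f x < a) /\
  (forall y, y < a -> exists2 x, x < cf a & y <= f x).
Proof. exact: (proj1 (ordminP a (cf_set0 a))). Qed.

Lemma cf_min a g (f : O -> O) : (forall x, x < g -> f x < a) ->
  (forall y, y < a -> exists2 x, x < g & y <= f x) -> cf a <= g.
Proof. by move=> fa fcof; apply: (proj2 (ordminP a (cf_set0 a))); exists f. Qed.

Lemma cf_le a : cf a <= a.
Proof. by apply: (@cf_min _ _ id) => // y ya; exists y. Qed.

Lemma cf_bound a g (f : O -> O) : g < cf a -> (forall x, x < g -> f x < a) ->
  exists2 y, y < a & forall x, x < g -> f x < y.
Proof.
move=> gcf fa; apply: contrapT => nb.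
suff: cf a <= g by rewrite leNgt gcf.
apply: (cf_min fa) => y ya; apply: contrapT => ny; apply: nb; exists y => // x xg.
by rewrite ltNge; apply/negP => yf; apply: ny; exists x.
Qed.

Lemma cf_bound_card {T : Type} (X : set T) a g (f : T -> O) : (exists b, b < a) ->
  g < cf a -> X #<= below g -> (forall x, X x -> f x < a) ->
  exists2 y, y < a & forall x, X x -> f x < y.
Proof.
move=> [b ba] gcf Xg fa; have [[t Xt]|X0] := EM (X !=set0); last first.
  by exists b => // x Xx; case: X0; exists x.
have [s sP] := card_leE_surj t Xg.
(* [s] may leave [X] on some arguments; these get the harmless value [f t]. *)
pose f' x := if `[< X (s x) >] then f (s x) else f t.
have [|y ya yb] := @cf_bound a g f' gcf.
  by move=> x _; rewrite /f'; case: asboolP => [/fa|_] //; exact: fa.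
exists y => // x Xx; have [z /yb + zx] := sP x Xx.
by rewrite /f' zx asboolT.
Qed.

Lemma limit_infinite_cardinal k : infinite_cardinal k -> is_limit k.
Proof.
move=> [kcard kinf]; split; first exact: (infinite_setN0 kinf).
move=> b bk; apply: contrapT => nb.
have sub : below k `<=` below b `|` [set b].
  move=> x xk; have [xb|bx|->] := ltgtP x b; [by left| |by right].
  by case: nb; exists x; rewrite bx.
apply: (kcard b bk); apply/Cantor_Bernstein.
  by apply: subset_card_le => x xb; exact: lt_trans xb bk.
apply: (card_le_trans (subset_card_le sub)); apply: infinite_card_setU1 => bfin.
by apply: kinf; apply: sub_finite_set sub _; rewrite finite_setU; split.
Qed.

(** If [a] had a last predecessor [b], the constant map [b] on a one-point ordinal would be cofinal,
    so [cf a] would be at most 1. In the proof [z] is 0 and [g] is 1. *)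
Lemma infinite_cf_limit a : infinite_set (below (cf a)) -> is_limit a.
Proof.
move=> cfinf; have [x0 x0cf] := infinite_setN0 cfinf.
have a0 : exists b, b < a by exists x0; exact: lt_le_trans x0cf (cf_le a).
split=> // b ba; apply: contrapT => nb.
have le_b y : y < a -> y <= b.
  by move=> ya; rewrite leNgt; apply/negP => bb; apply: nb; exists y; rewrite bb.
have [z _ zmin] := ex_min (X := setT) (ex_intro _ a I).
have [g zg gmin] := ex_min (X := [set g | z < g])
  (ex_intro _ a (le_lt_trans (zmin b I) ba)).
apply: cfinf; apply: (sub_finite_set _ (finite_set1 z)) => x xcf.
have xg : x < g.
  by apply: lt_le_trans xcf _; apply: (@cf_min _ _ (fun=> b)) => // y /le_b; exists z.
apply/eqP; rewrite eq_le zmin // andbT leNgt; apply/negP => zx.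
by have := gmin x zx; rewrite leNgt xg.
Qed.

Lemma not_limit_pred a : (exists b, b < a) -> ~ is_limit a ->
  exists2 p, p < a & forall x, x < a -> x <= p.
Proof.
move=> a0 nl; apply: contrapT => np; apply: nl; split=> // b ba.
apply: contrapT => nb; apply: np; exists b => // x xa.
by rewrite leNgt; apply/negP => bx; apply: nb; exists x; rewrite bx.
Qed.

Lemma infinite_mono a b : a <= b -> infinite_set (below a) -> infinite_set (below b).
Proof. by move=> ab; apply: sub_infinite_set => x xa; exact: lt_le_trans xa ab. Qed.

End WellOrder.

(** * Regular cardinals and the club filter *)

Section Regularity.
Context {d : Order.disp_t} {O : orderType d} (wfO : ord_wf O).
Implicit Types (a b g k l w : O) (X Y C D S : set O).
Lemma omega_countable w : is_omega w -> countable (below w).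
Proof.
move=> [_ wfin]; apply: (card_le_inj (f := fun x : O => #|` fset_set (@below d O x)|)) => //.
have mono x y : x < y -> y < w ->
    (#|` fset_set (@below d O x)| < #|` fset_set (@below d O y)|)%N.
  move=> xy yw; have xw := lt_trans xy yw.
  apply: fproper_ltn_card; rewrite fproperE; apply/andP; split.
    apply/fsubsetP => z; rewrite !in_fset_set; try exact: wfin.
    by move=> /set_mem zx; apply/mem_set; exact: lt_trans zx xy.
  apply/fsubsetPn; exists x; rewrite in_fset_set; try exact: wfin.
    exact/mem_set.
  by apply/negP => /set_mem; rewrite /below /= ltxx.
move=> x y xw yw e; have [xy|yx|//] := ltgtP x y.
  by have := mono _ _ xy yw; rewrite e ltnn.
by have := mono _ _ yx xw; rewrite e ltnn.
Qed.

Lemma ex_omega a : infinite_set (below a) -> exists2 w, is_omega w & w <= a.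
Proof.
move=> ainf; have [w winf wmin] :=
  ex_min wfO (X := [set w | infinite_set (below w)]) (ex_intro _ a ainf).
exists w; last exact: wmin.
by split=> // b bw; apply: contrapT => binf; have := wmin b binf; rewrite leNgt bw.
Qed.

Section Regular.
Variable k : O.
Hypothesis kreg : regular_cardinal k.

Let klim : is_limit k. Proof. exact: limit_infinite_cardinal (proj1 kreg). Qed.

Lemma regular_bound g (f : O -> O) : g < k -> (forall x, x < g -> f x < k) ->
  exists2 y, y < k & forall x, x < g -> f x < y.
Proof. by move=> gk; apply: cf_bound => //; rewrite (proj2 kreg). Qed.

Lemma regular_bound_card {T : Type} (X : set T) g (f : T -> O) :
  g < k -> X #<= below g -> (forall x, X x -> f x < k) ->
  exists2 y, y < k & forall x, X x -> f x < y.
Proof.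
by move=> gk; apply: cf_bound_card => //; [exact: (proj1 klim)|rewrite (proj2 kreg)].
Qed.

(** Take for [f p] the least element of [G p] above all earlier values; these are bounded below [k]
    by regularity. *)
Lemma increasing_selection (G : O -> set O) : (forall p, p < k -> unbounded_in k (G p)) ->
  exists f : O -> O, (forall p, p < k -> G p (f p) /\ f p < k) /\
                     (forall p q, q < p -> p < k -> f q < f p).
Proof.
move=> Gunb; have [f fE] := wf_rec wfO k (fun p rec =>
  ordmin k (G p `&` [set x | x < k /\ forall q, q < p -> rec q < x])).
have fP p : p < k -> (G p `&` [set x | x < k /\ forall q, q < p -> f q < x]) (f p).
  elim/(ord_ind wfO): p => p IH pk.
  have -> : f p = ordmin k (G p `&` [set x | x < k /\ forall q, q < p -> f q < x]).
    rewrite fE; congr ordmin; apply/seteqP.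
    split=> x [Gx [xk xb]]; split=> //; split=> // q qp.
      by have := xb q qp; rewrite asboolT.
    by rewrite asboolT //; exact: xb.
  have [|y yk yb] := regular_bound (f := f) pk.
    by move=> q qp; have [_ []] := IH q qp (lt_trans qp pk).
  apply: (proj1 (ordminP _ _ _)) => //; have [x Gx /andP[yx xk]] := Gunb p pk y yk.
  by exists x; split=> //; split=> // q /yb qy; exact: lt_trans qy yx.
exists f; split=> [p /fP[Gp [fk _]] //|p q qp /fP[_ [_]]]; exact.
Qed.

Lemma unbounded_card X : unbounded_in k X -> below k #<= X.
Proof.
move=> Xunb; have [//|f [fX fmono]] := increasing_selection (G := fun=> X).
apply: (card_le_inj (f := f)) => [x /fX[]//|x y xk yk e].
by have [xy|yx|//] := ltgtP x y;
  [have := fmono _ _ xy yk|have := fmono _ _ yx xk]; rewrite e ltxx.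
Qed.

Lemma club_below : club_in k (below k).
Proof.
split=> // b bk; have [c /andP[bc ck]] := klim.2 b bk.
by exists c; rewrite ?bc.
Qed.

Lemma club_tail D b : club_in k D -> b < k -> club_in k (D `&` [set a | b < a]).
Proof.
move=> [Dk Dunb Dcl] bk; split=> [x [/Dk]//|c ck|c ck cacc].
  have bck : Order.max b c < k by rewrite gt_max bk.
  have [x Dx /andP[mx xk]] := Dunb _ bck.
  by move: mx; rewrite gt_max => /andP[bx cx]; exists x => //; rewrite cx.
split; last by have [[e ec] /(_ e ec)[x [_ /= bx] /andP[_ xc]]] := cacc; exact: lt_trans xc.
apply: (Dcl c ck); case: cacc => c0 cX; split=> // e /cX[x [Dx _] exc].
by exists x.
Qed.

Lemma stationary_unbounded S b : stationary_in k S -> b < k ->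
  exists2 a, S a & b < a.
Proof.
by move=> [_ Sst] bk; have [a [Sa [_ ba]]] := Sst _ (club_tail club_below bk); exists a.
Qed.

Lemma stationary_mono S S' : stationary_in k S -> S `<=` S' -> S' `<=` below k ->
  stationary_in k S'.
Proof.
by move=> [_ Sst] SS Sk; split=> // C /Sst[a [Sa Ca]]; exists a; split=> //; exact: SS.
Qed.

Lemma stationary_tail S b : stationary_in k S -> b < k ->
  stationary_in k (S `&` [set a | b < a]).
Proof.
move=> [Sk Sst] bk; split=> [x [/Sk]//|C clubC].
by have [a [Sa [Ca ba]]] := Sst _ (club_tail clubC bk); exists a.
Qed.

Hypothesis kunc : ~ countable (below k).

Lemma nat_bound (u : nat -> O) : (forall n, u n < k) ->
  exists2 y, y < k & forall n, u n < y.
Proof.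
move=> uk; have [w wom wk] := ex_omega (proj2 (proj1 kreg)).
have {}wk : w < k.
  rewrite lt_neqAle wk andbT; apply/eqP => wk'; apply: kunc.
  by rewrite -wk'; exact: omega_countable.
have [|//|y yk yb] := @regular_bound_card _ [set: nat] w u wk.
  by case: wom => /infiniteP.
by exists y => // n; exact: yb.
Qed.

(** Unboundedness is a closing-off argument: iterate omega times a step from [x] to some [y] such
    that every [D z] with [z < x] meets the interval [(x, y)], and take the supremum, which is below
    [k] by regularity and uncountability. *)
Lemma club_diag (D : O -> set O) : (forall x, x < k -> club_in k (D x)) ->
  club_in k [set a | a < k /\ forall x, x < a -> D x a].
Proof.
move=> clubD; split=> [a []//|b bk|b bk bacc]; last first.
  split=> // x xb; have [_ _ Dcl] := clubD x (lt_trans xb bk).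
  apply: Dcl => //; case: bacc => b0 bX; split=> // y yb.
  have xyb : Order.max x y < b by rewrite gt_max xb.
  have [z [zk zD] /andP[mz zb]] := bX _ xyb.
  move: mz; rewrite gt_max => /andP[xz yz].
  by exists z; [exact: zD|rewrite yz].
have step x : x < k -> exists y, [/\ x < y, y < k &
    forall z, z < x -> exists2 t, D z t & x < t < y].
  move=> xk; have /(choice_on k)[N NP] :
      forall z, z < x -> exists t, D z t /\ x < t < k.
    move=> z zx; have [_ Dunb _] := clubD z (lt_trans zx xk).
    by have [t] := Dunb x xk; exists t.
  have [|y yk yb] := regular_bound (f := N) xk.
    by move=> z /NP[_ /andP[]].
  have xyk : Order.max x y < k by rewrite gt_max xk.
  have [c /andP[mc ck]] := klim.2 _ xyk.
  move: mc; rewrite gt_max => /andP[xc yc].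
  exists c; split=> // z zx; have [DN /andP[xN _]] := NP z zx.
  by exists (N z); rewrite // xN (lt_trans (yb z zx)).
have {step}[G GP] := choice_on k step.
pose u n := iter n G b.
have uk n : u n < k by elim: n => [//|n IH] /=; have [] := GP _ IH.
have uS n : u n < u n.+1 by have [] := GP _ (uk n).
have umono : {homo u : m n / (m <= n)%N >-> m <= n}.
  by apply: homo_leq => // [x y z|n]; [exact: le_trans|exact: ltW].
have [y yk yb] := nat_bound uk.
(* [m] is the supremum of the [u n]. For [x < m], [D x] meets [(u n, u n.+1)] for all large [n],
   hence accumulates at [m]. *)
have [m mub mmin] := ex_min wfO (X := [set y | forall n, u n < y]) (ex_intro _ y yb).
have below_m x : x < m -> exists n, x < u n.
  move=> xm; apply: contrapT => nx; suff : m <= x by rewrite leNgt xm.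
  apply: mmin => n; apply: (lt_le_trans (uS n)); rewrite leNgt.
  by apply/negP => xu; apply: nx; exists n.+1.
have mk : m < k by apply: le_lt_trans (mmin _ yb) yk.
exists m; last by rewrite mk andbT; exact: (mub 0%N).
split=> // x xm; have [_ _ Dcl] := clubD x (lt_trans xm mk).
apply: Dcl => //; split=> [|c cm]; first by exists b; exact: (mub 0%N).
have [n1 xn] := below_m x xm; have [n2 cn] := below_m c cm.
pose n := maxn n1 n2; have [_ _ Gz] := GP (u n) (uk n).
have [|t Dt /andP[ut tu]] := Gz x.
  by apply: lt_le_trans xn _; apply: umono; exact: leq_maxl.
exists t => //; apply/andP; split; last by apply: lt_trans tu _; exact: (mub n.+1).
by apply: le_lt_trans ut; apply: (le_trans (ltW cn)); apply: umono; exact: leq_maxr.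
Qed.

(** Otherwise each [l] has a club [D l] on which [f] never takes the value [l] at points of [S]. A
    point [a] of [S] in the diagonal intersection lies in [D (f a)], because [f a < a]. *)
Lemma fodor S (f : O -> O) : stationary_in k S -> (forall a, S a -> f a < a) ->
  exists2 l, l < k & stationary_in k (S `&` [set a | f a = l]).
Proof.
move=> [Sk Sst] freg; apply: contrapT => nst.
have /(choice_on setT)[D DP] : forall l, l < k -> exists C, club_in k C /\
    forall a, S a -> C a -> f a <> l.
  move=> l lk; apply: contrapT => nC; apply: nst; exists l => //.
  split=> [a [/Sk]//|C clubC]; apply: contrapT => Cdisj; apply: nC.
  by exists C; split=> // a Sa Ca fa; apply: Cdisj; exists a.
have [a [Sa [ak Da]]] := Sst _ (club_diag (fun x xk => (DP x xk).1)).
have fa := freg a Sa; have [_] := DP (f a) (lt_trans fa ak).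
by move=> /(_ a Sa (Da _ fa)).
Qed.

Lemma club_closure (f : O -> O) : (forall x, x < k -> f x < k) ->
  club_in k [set a | a < k /\ forall x, x < a -> f x < a].
Proof.
move=> fk; have /club_diag : forall x, x < k -> club_in k (below k `&` [set a | f x < a]).
  by move=> x xk; apply: club_tail (fk x xk); exact: club_below.
by congr club_in; apply/seteqP; split=> a [ak ca]; split=> // x /ca //= [].
Qed.

End Regular.

End Regularity.

(** * Cardinal arithmetic *)

Lemma card_setX_le {T T' U U' : Type} (t0 : T') (u0 : U')
    {A : set T} {A' : set T'} {B : set U} {B' : set U'} :
  A #<= A' -> B #<= B' -> (A `*` B) #<= (A' `*` B').
Proof.
move=> /(card_leE t0)[f fA finj] /(card_leE u0)[g gB ginj].
apply: (card_le_inj (f := fun p => (f p.1, g p.2))) => [p [/fA ? /gB ?] //|].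
move=> [x y] [x' y'] [/= Ax By] [/= Ax' By'] [/finj-> // /ginj-> //].
Qed.

Section CardinalArithmetic.
Context {d : Order.disp_t} {O : orderType d} (wfO : ord_wf O).
Implicit Types (a b k l m w x y chi nu : O) (p q : O * O).

(* The Goedel ordering of pairs: by maximum, then lexicographically. *)
Definition pair_lt p q :=
  Order.max p.1 p.2 < Order.max q.1 q.2 \/
  Order.max p.1 p.2 = Order.max q.1 q.2 /\
    (p.1 < q.1 \/ p.1 = q.1 /\ p.2 < q.2).

Lemma pair_lt_wf : well_founded pair_lt.
Proof.
suff H m a b p : Order.max p.1 p.2 = m -> p.1 = a -> p.2 = b -> Acc pair_lt p.
  by move=> p; exact: H.
elim/(ord_ind wfO): m a b p => m IHm a; elim/(ord_ind wfO): a => a IHa b.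
elim/(ord_ind wfO): b => b IHb p mE aE bE; constructor => q.
case=> [|[qE]]; first by rewrite mE => /IHm; apply.
case=> [|[aE']]; first by rewrite aE => /IHa; apply=> //; rewrite qE.
by rewrite bE => /IHb; apply=> //; [rewrite qE|rewrite aE'].
Qed.

Lemma pair_lt_total p q : p <> q -> pair_lt p q \/ pair_lt q p.
Proof.
case: p q => [a b] [a' b'] ne; rewrite /pair_lt /=.
case: (ltgtP (Order.max a b) (Order.max a' b')) => [?|?|->]; [by left; left|by right; left|].
case: (ltgtP a a') => [?|?|e]; [by left; right; split=> //; left|
  by right; right; split=> //; left|].
case: (ltgtP b b') => [?|?|e']; [by left; right; split=> //; right|
  by right; right; split=> //; right|].
by case: ne; rewrite e e'.
Qed.

Lemma ex_card x : exists b, [/\ b <= x, is_cardinal b & below b #= below x].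
Proof.
have [b bx bmin] := ex_min wfO (X := [set b | below b #= below x])
  (ex_intro _ x (card_eqxx _)).
exists b; split=> //; first exact/bmin/card_eqxx.
move=> c cb /card_eq_trans/(_ bx)/bmin; by rewrite leNgt cb.
Qed.

Lemma cardinal_not_le k b : is_cardinal k -> b < k -> ~ (below k #<= below b).
Proof.
move=> kcard bk kb; apply: (kcard b bk); apply: Cantor_Bernstein kb.
by apply: subset_card_le => x xb; exact: lt_trans xb bk.
Qed.

(** Hessenberg's theorem. For a cardinal [k], the injection [r] is the collapse of the Goedel
    ordering: [r p] is the least value not taken before [p]. *)
Lemma card_below_square k : infinite_set (below k) ->
  (below k `*` below k) #<= below k.
Proof.
elim/(ord_ind wfO): k => k IH kinf.
have [ncard|kcard] := EM (exists2 b, b < k & below b #= below k).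
  have [b bk bE] := ncard; have [bk' kb] := proj1 (card_eqPle _ _) bE.
  apply: (card_le_trans (card_setX_le k k kb kb)); apply: card_le_trans bk'.
  by apply: IH => // bfin; apply: kinf; exact: card_le_finite kb bfin.
have {}kcard : is_cardinal k by move=> b bk bE; apply: kcard; exists b.
have klim : is_limit k by apply: limit_infinite_cardinal; split.
have [r rE] := wf_rec pair_lt_wf k (fun p rec =>
  ordmin k [set x | x < k /\ forall q, pair_lt q p -> rec q <> x]).
have rP p : (below k `*` below k) p ->
    r p < k /\ forall q, pair_lt q p -> r q <> r p.
  move=> [/= p1k p2k].
  have -> : r p = ordmin k [set x | x < k /\ forall q, pair_lt q p -> r q <> x].
    rewrite {1}rE; congr ordmin; apply/seteqP.
    split=> x [xk xP]; split=> // q qp; first by have := xP q qp; rewrite asboolT.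
    by rewrite asboolT //; exact: xP.
  (* If no value were free at [p], then [r] would map the predecessors of [p], all inside the square
     of some [m < k], onto [below k]; the induction hypothesis for [m] forbids this. *)
  set X := [set x | _]; suff /(ordminP wfO k)[//] : X !=set0.
  apply: contrapT => nx.
  have [|m /andP[pm mk]] := proj2 klim (Order.max p.1 p.2).
    by rewrite gt_max; apply/andP; split.
  apply: (@cardinal_not_le k m) => //.
  have km : below k #<= (below m `*` below m).
    apply: (card_le_surj (f := r)) => x xk; apply: contrapT => nq; apply: nx.
    exists x; split=> // q qp qx; apply: nq; exists q => //.
    have : Order.max q.1 q.2 < m by apply: le_lt_trans pm; case: qp => [/ltW|[->]].
    by rewrite gt_max => /andP[].
  apply: (card_le_trans km); apply: IH => // mfin.
  by apply: kinf; apply: (card_le_finite km); exact: finite_setX.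
apply: (card_le_inj (f := r)) => [p /rP[]//|p q pk qk e]; apply: contrapT => ne.
by case: (pair_lt_total ne) => [/(proj2 (rP q qk))|/(proj2 (rP p pk))]; rewrite e.
Qed.

Section Successor.
Variables l k : O.
Hypotheses (linf : infinite_set (below l)) (lk : is_successor_cardinal l k).

Lemma below_successor_le x : x < k -> below x #<= below l.
Proof.
case: lk => kcard lltk lmax xk; have [b [bx bcard bE]] := ex_card x.
have bl : b <= l.
  by rewrite leNgt; apply/negP => /lmax; apply=> //; exact: le_lt_trans xk.
rewrite -(card_le_eql bE); apply: subset_card_le => y yb.
exact: lt_le_trans yb bl.
Qed.

Lemma successor_infinite : infinite_cardinal k.
Proof. by case: lk => kcard lltk _; split=> //; apply: infinite_mono (ltW lltk) linf. Qed.

(** If [cf k < k], a cofinal map covers [k] by at most [l] sets of size at most [l]. Each [y] is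
    then coded by a pair below [l]: the index [t y] of a set containing it, and its place in that
    set. *)
Lemma successor_regular : regular_cardinal k.
Proof.
have kinf := successor_infinite; split=> //; have [kcard lltk _] := lk.
apply/eqP; rewrite eq_le cf_le //= leNgt; apply/negP => cfk.
have [f [fk fcof]] := cf_fun wfO k.
have /(choice_on id)[e eP] : forall x, x < k -> exists e : O -> O,
    (forall y, y < x -> e y < l) /\
    (forall y y', y < x -> y' < x -> e y = e y' -> y = y').
  by move=> x /below_successor_le/(card_leE x)[e ? ?]; exists e.
have /(choice_on k)[t tP] : forall y, y < k -> exists x, x < cf k /\ y < f x.
  move=> y yk; have [z /andP[yz zk]] := proj2 (limit_infinite_cardinal kinf) y yk.
  by have [x xcf zf] := fcof z zk; exists x; split=> //; exact: lt_le_trans zf.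
apply: (cardinal_not_le kcard lltk); apply: card_le_trans (card_below_square linf).
apply: (card_le_inj (f := fun y => (e (cf k) (t y), e (f (t y)) y))).
  move=> y yk; have [tcf yf] := tP y yk; split=> /=; first exact: (proj1 (eP _ cfk)).
  exact: (proj1 (eP _ (fk _ tcf))).
move=> y y' yk y'k []; have [tcf yf] := tP y yk; have [tcf' yf'] := tP y' y'k.
move=> /(proj2 (eP _ cfk) _ _ tcf tcf') tE; rewrite -tE in yf' *.
exact: (proj2 (eP _ (fk _ tcf))).
Qed.

End Successor.

(** A shorter cofinal map would make [below w] a finite union of finite sets. *)
Lemma omega_regular w : is_omega w -> regular_cardinal w.
Proof.
move=> [winf wfin]; have wcard : infinite_cardinal w.
  split=> // b bw bE; apply: winf; apply: card_le_finite (wfin b bw).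
  by have [] := proj1 (card_eqPle _ _) bE.
split=> //; apply/eqP; rewrite eq_le cf_le //= leNgt; apply/negP => cfw.
have [f [fw fcof]] := cf_fun wfO w; apply: winf.
apply: (@sub_finite_set _ _ (\bigcup_(x in below (cf w)) (below (f x) `|` [set f x]))).
  move=> y yw; have [x xcf yf] := fcof y yw; exists x => //.
  by move: yf; rewrite le_eqVlt => /orP[/eqP|]; [right|left].
apply: bigcup_finite; first exact: wfin.
by move=> x xcf; rewrite finite_setU; split=> //; apply/wfin/fw.
Qed.

(** As [chi] may be singular, this supplies the regular cardinal with which [club_cof] reaches
    cofinalities above [nu]: omega for finite [nu], otherwise the least cardinal above [nu]. *)
Lemma regular_above chi nu : infinite_cardinal chi -> nu < chi ->
  exists r, [/\ regular_cardinal r, nu < r & r <= chi].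
Proof.
move=> [chicard chiinf] nuchi; have [nufin|nuinf] := EM (finite_set (below nu)).
  have [w wom wchi] := ex_omega wfO chiinf; exists w; split=> //.
    exact: omega_regular.
  rewrite ltNge; apply/negP => wnu; case: wom => winf _.
  exact: (infinite_mono wnu winf).
have [r [rcard nur] rmin] := ex_min wfO
  (X := [set r | is_cardinal r /\ nu < r]) (ex_intro _ chi (conj chicard nuchi)).
exists r; split=> //; last exact: rmin.
apply: (@successor_regular nu) => //; split=> // b nub br bcard.
by have := rmin b (conj bcard nub); rewrite leNgt br.
Qed.

End CardinalArithmetic.

(** * Walks on ordinals *)

Section Walks.
Context {d : Order.disp_t} {O : orderType d} (wfO : ord_wf O).
Implicit Types (a b g k l w x y z xi eta chi nu rho theta : O) (X D : set O)
  (C E : O -> set O).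

(** Take the supremum [a] of the first [rho] terms of an increasing sequence in [D]. A cofinal map
    from an ordinal below [rho] into [a] would, by regularity of [rho], be dominated by a single
    term of the sequence. *)
Lemma club_cof k rho D : regular_cardinal k -> regular_cardinal rho -> rho < k ->
  club_in k D -> exists2 a, D a & rho <= cf a.
Proof.
move=> kreg rreg rk [_ Dunb Dcl].
have [//|f [fD fmono]] := increasing_selection wfO kreg (G := fun=> D).
have [y yk yb] := regular_bound wfO kreg (f := f) rk
  (fun p pr => proj2 (fD p (lt_trans pr rk))).
have [a ab amin] := ex_min wfO (X := [set y | forall p, p < rho -> f p < y])
  (ex_intro _ y yb).
have [[p0 p0r] rlim] := limit_infinite_cardinal (proj1 rreg).
have below_a x : x < a -> exists2 p, p < rho & x <= f p.
  move=> xa; apply: contrapT => np; suff : a <= x by rewrite leNgt xa.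
  apply: amin => p pr; rewrite ltNge; apply/negP => xf; apply: np.
  by exists p.
have ak : a < k by apply: le_lt_trans yk; exact: amin.
exists a.
  apply: Dcl => //; split=> [|b /below_a[p pr bp]]; first by exists (f p0); exact: ab.
  have [q /andP[pq qr]] := rlim p pr; have qk := lt_trans qr rk.
  exists (f q); first exact: (proj1 (fD q qk)).
  by rewrite (le_lt_trans bp (fmono _ _ pq qk)) ab.
rewrite leNgt; apply/negP => cfr; have [h [ha hcof]] := cf_fun wfO a.
have /(choice_on a)[s sP] : forall x, x < cf a -> exists p, p < rho /\ h x <= f p.
  by move=> x /ha/below_a[p]; exists p.
have [|p pr pb] := regular_bound wfO rreg (f := s) cfr; first by move=> x /sP[].
have [x xcf px] := hcof _ (ab p pr); have [_ hx] := sP x xcf.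
have := fmono _ _ (pb x xcf) (lt_trans pr rk).
by rewrite ltNge (le_trans px hx).
Qed.

(** The step min(X \ a) of a walk from an ordinal with ladder [X] down towards [a]. *)
Definition nxt X a := ordmin a (X `&` [set x | a <= x]).

Lemma nxtP X a : (exists2 x, X x & a <= x) ->
  [/\ X (nxt X a), a <= nxt X a & forall x, X x -> a <= x -> nxt X a <= x].
Proof.
move=> [x Xx ax].
have /(ordminP wfO a)[[Xn an] nmin] : X `&` [set x | a <= x] !=set0 by exists x.
by split=> // y Xy ay; apply: nmin.
Qed.

Lemma nxt_eq X a x : X x -> a <= x -> (forall y, X y -> a <= y -> x <= y) ->
  nxt X a = x.
Proof.
move=> Xx ax xmin; have [|Xn an nmin] := @nxtP X a; first by exists x.
by apply/eqP; rewrite eq_le nmin //= xmin.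
Qed.

(* [c a b] is the maximum of [h] over the walk from [b] down to [a] along [C],
   excluding its last point [a]. *)
Lemma walk_colouring C (h : O -> O) z : exists c : O -> O -> O,
  [/\ forall theta a b, z < theta -> (forall x, h x < theta) -> c a b < theta,
      forall a b, a < b -> h b <= c a b &
      forall a b, a < b -> nxt (C b) a < b -> c a (nxt (C b) a) <= c a b].
Proof.
(* The recursion is on the upper point [b] and yields a function of [a]. The value [z] is returned
   once the walk has reached [a]. *)
have [f fE] := wf_rec wfO (fun=> z) (fun b (rec : O -> O -> O) a =>
  if a < b then Order.max (h b) (rec (nxt (C b) a) a) else z).
exists (fun a b => f b a); split=> [theta a b zt ht|a b ab|a b ab nb].
- elim/(ord_ind wfO): b => b IH; rewrite fE; case: ifP => // _.
  by rewrite gt_max ht /=; case: asboolP => // /IH.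
- by rewrite fE ab le_max lexx.
- by rewrite (fE b) ab asboolT // le_max lexx orbT.
Qed.

(** Induction on [b]. If [b = dl] or [C b] accumulates at [dl], the first step of the walk already
    sees the value [h dl]. Otherwise [C b] misses an interval [(l0, dl)], so walks towards [dl] and
    towards any [a] in that interval take the same step, and induction applies to its endpoint. *)
Lemma walk_low k C (h : O -> O) (c : O -> O -> O) dl :
  (forall a b, a < b -> h b <= c a b) ->
  (forall a b, a < b -> nxt (C b) a < b -> c a (nxt (C b) a) <= c a b) ->
  (forall a b, a < b -> b < k -> exists2 x, C b x & a <= x < b) ->
  (forall b, dl < b -> b < k -> acc_point (C b) dl -> h b = h dl) ->
  (exists b, b < dl) ->
  forall b, dl <= b -> b < k ->
  exists2 l, l < dl & forall a, l < a -> a < dl -> h dl <= c a b.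
Proof.
move=> ch cn Cunb hacc [b0 b0d]; elim/(ord_ind wfO) => b IH.
rewrite le_eqVlt => /orP[/eqP<- _|db bk].
  by exists b0 => // a _; exact: ch.
have [/(hacc b db bk) hb|nacc] := EM (acc_point (C b) dl).
  by exists b0 => // a _ ad; rewrite -hb; apply: ch; exact: lt_trans ad db.
have [l0 l0d l0C] : exists2 l, l < dl & forall x, C b x -> l < x -> dl <= x.
  apply: contrapT => nl; apply: nacc; split=> [|l ld]; first by exists b0.
  apply: contrapT => nx; apply: nl; exists l => // x Cx lx.
  by rewrite leNgt; apply/negP => xd; apply: nx; exists x; rewrite ?lx.
have [x Cx /andP[dx xb]] := Cunb dl b db bk.
have [|Cn dn nmin] := @nxtP (C b) dl; first by exists x.
have nb : nxt (C b) dl < b by apply: le_lt_trans xb; exact: nmin.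
have [l1 l1d l1P] := IH _ nb dn (lt_trans nb bk).
exists (Order.max l0 l1); first by rewrite gt_max l0d.
move=> a; rewrite gt_max => /andP[l0a l1a] ad.
have nE : nxt (C b) a = nxt (C b) dl.
  apply: nxt_eq => // [|y Cy ay]; first exact: le_trans (ltW ad) dn.
  by apply: nmin => //; apply: l0C => //; exact: lt_le_trans l0a ay.
apply: (le_trans (l1P a l1a ad)); rewrite -nE; apply: cn; first exact: lt_trans ad db.
by rewrite nE.
Qed.

(** List the fewer than [k] pairs [(nu, i)] and pick distinct elements of the sets [G nu], one for
    each entry of the list; distinctness lets a single [h] assign [i] to the element picked for
    [(nu, i)]. *)
Lemma spread k chi theta (G : O -> set O) : regular_cardinal k ->
  chi < k -> infinite_cardinal theta -> theta < k ->
  (forall nu, nu < chi -> unbounded_in k (G nu)) ->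
  exists2 h : O -> O, forall x, h x < theta &
    forall nu i, nu < chi -> i < theta -> exists2 g, G nu g & h g = i.
Proof.
move=> kreg chik thinf thk Gunb; pose mu := Order.max chi theta.
have [i0 i0t] := infinite_setN0 (proj2 thinf).
have muk : mu < k by rewrite gt_max chik.
have lemu a : a <= mu -> below a #<= below mu.
  by move=> amu; apply: subset_card_le => x xa; exact: lt_le_trans amu.
have muinf : infinite_set (below mu).
  by apply: infinite_mono (proj2 thinf); rewrite le_max lexx orbT.
have /(card_leE_surj (k, k))[s sP] : (below chi `*` below theta) #<= below mu.
  apply: card_le_trans (card_below_square wfO muinf).
  by apply: (card_setX_le k k); apply: lemu; rewrite le_max lexx ?orbT.
(* The enumeration [s] is constrained only below [mu]; the premise [(s p).1 < chi] makes the
   selection possible at every [p < k]. *)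
have [|f [fG fmono]] :=
  increasing_selection wfO kreg (G := fun p x => (s p).1 < chi -> G (s p).1 x).
  move=> p _ b bk; have [sp|nchi] := EM ((s p).1 < chi).
    by have [x Gx bx] := Gunb _ sp b bk; exists x.
  have [c bck] := proj2 (limit_infinite_cardinal (proj1 kreg)) b bk.
  by exists c.
have finj p q : p < k -> q < k -> f p = f q -> p = q.
  move=> pk qk e; have [pq|qp|//] := ltgtP p q.
    by have := fmono _ _ pq qk; rewrite e ltxx.
  by have := fmono _ _ qp pk; rewrite e ltxx.
have /(choice_on i0)[h hP] : forall x, True -> exists i, i < theta /\
    forall p, p < k -> f p = x -> (s p).2 < theta -> i = (s p).2.
  move=> x _; have [[p [pk fp sp]]|np] :=
      EM (exists p, [/\ p < k, f p = x & (s p).2 < theta]).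
    by exists (s p).2; split=> // q qk fq _; rewrite (finj p q) // fp.
  by exists i0; split=> // p pk fp sp; case: np; exists p.
exists h => [x|nu i nuchi it]; first exact: (proj1 (hP x I)).
have [|p pmu sE] := sP (nu, i); first by split.
have pk := lt_trans pmu muk; have [Gp _] := fG p pk.
exists (f p); first by move: Gp; rewrite sE; apply.
by rewrite (proj2 (hP (f p) I) p pk erefl) sE.
Qed.

(** * The colouring from an abstract ladder system *)

Section Construction.
(** Common abstraction of both hypotheses. [E nu] holds the points [dl] used against families of
    sets of size [nu]: their cofinality exceeds [nu] and ladders accumulating at them cohere there.
    [Cthread] forbids a club along which the ladders at points of [E nu] accumulate at all smaller
    such points. *)
Variables (k chi theta : O) (C E : O -> set O).
Hypotheses (kru : regular_uncountable k)
  (chiinf : infinite_cardinal chi) (chik : chi < k)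
  (thinf : infinite_cardinal theta) (thk : theta < k)
  (Cclub : forall a, a < k -> is_limit a -> club_in a (C a))
  (Ecof : forall nu a, nu < chi -> E nu a -> [/\ a < k, is_limit a & nu < cf a])
  (Ccoh : forall nu a b, nu < chi -> E nu a -> a < b -> b < k -> is_limit b ->
     acc_point (C b) a -> C a = C b `&` below a)
  (Cthread : forall nu D, nu < chi -> club_in k D ->
     exists a g, [/\ D a /\ E nu a, D g /\ E nu g, g < a & ~ acc_point (C a) g]).

Let kreg : regular_cardinal k := proj1 kru.
Let klim : is_limit k := limit_infinite_cardinal (proj1 kreg).

Lemma ladder_nxt nu xi a : nu < chi -> E nu a -> xi < a ->
  [/\ C a (nxt (C a) xi), xi <= nxt (C a) xi, nxt (C a) xi < a &
      forall x, C a x -> xi <= x -> nxt (C a) xi <= x].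
Proof.
move=> nuchi Ea xia; have [ak alim _] := Ecof nuchi Ea.
have [Ca Cunb _] := Cclub ak alim; have [x Cx /andP[xix xa]] := Cunb xi xia.
have [|? ? nmin] := @nxtP (C a) xi; first by exists x => //; exact: ltW.
by split=> //; apply: le_lt_trans xa; apply: nmin => //; exact: ltW.
Qed.

(** Otherwise, for each [xi], the values [nxt (C a) xi] are bounded for all [a] in [E nu] above [xi]
    and in some club. At points [g < a] of [E nu] in the diagonal intersection of these clubs and
    bounds, [C a] meets every final segment of [g], against [Cthread]. *)
Lemma ex_spreading_level nu : nu < chi -> exists2 xi, xi < k & forall eta, eta < k ->
  stationary_in k [set a | [/\ E nu a, xi < a & eta <= nxt (C a) xi]].
Proof.
move=> nuchi; apply: contrapT => nxi.
have /(choice_on (k, set0))[F FP] : forall xi, xi < k -> exists eD : O * set O,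
    [/\ eD.1 < k, club_in k eD.2 & forall a, E nu a -> xi < a -> eD.2 a ->
        nxt (C a) xi < eD.1].
  move=> xi xik; apply: contrapT => nF; apply: nxi; exists xi => // eta etak.
  split=> [a [/(Ecof nuchi)[]]//|D clubD]; apply: contrapT => SD; apply: nF.
  exists (eta, D); split=> //= a Ea xia Da; rewrite ltNge; apply/negP => le_eta.
  by apply: SD; exists a.
have clubD : club_in k [set a | a < k /\ forall x, x < a ->
    ((F x).2 `&` [set a | (F x).1 < a]) a].
  apply: (club_diag wfO kreg (proj2 kru)) => x /FP[? ? _]; exact: club_tail.
have [a [g [[[ak Da] Ea] [[gk Dg] Eg] ga nacc]]] := Cthread nuchi clubD.
have [_ [g0 glim] _] := Ecof nuchi Eg; apply: nacc; split=> // b bg.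
(* [nxt (C a) b] could be [b] itself, so the ladder is queried at some [x] strictly above [b]. *)
have [x /andP[bx xg]] := glim b bg; have xa := lt_trans xg ga.
have [_ _ FPx] := FP x (lt_trans xg gk).
have [Dax _] := Da x xa; have [_ /= xlow] := Dg x xg.
have [Cn xn _ _] := ladder_nxt nuchi Ea xa.
exists (nxt (C a) x) => //.
by rewrite (lt_le_trans bx xn) /=; exact: lt_trans (FPx a Ea xa Dax) xlow.
Qed.

(** As [nxt (C a) xi] grows with [xi], one [xi] above all levels [Xi nu] serves every [nu < chi].
    Fodor then fixes the regressive value [nxt (C a) xi] on a stationary set, and it can be forced
    above any [b]. *)
Lemma ex_uniform_level : exists2 xi, xi < k & forall nu, nu < chi ->
  unbounded_in k [set g |
    stationary_in k [set a | [/\ E nu a, xi < a & nxt (C a) xi = g]]].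
Proof.
have /(choice_on k)[Xi XiP] : forall nu, nu < chi -> exists xi, xi < k /\
    forall eta, eta < k ->
    stationary_in k [set a | [/\ E nu a, xi < a & eta <= nxt (C a) xi]].
  by move=> nu /ex_spreading_level[xi]; exists xi.
have [|xi xik xiP] := regular_bound wfO kreg (f := Xi) chik.
  by move=> nu /XiP[].
exists xi => // nu nuchi b bk; have [b' /andP[bb' b'k]] := proj2 klim b bk.
have [_ /(_ b' b'k)/stationary_tail/(_ xik) Sst] := XiP nu nuchi.
have [|l lk lst] := fodor wfO kreg (proj2 kru) (f := fun a => nxt (C a) xi) Sst.
  by move=> a [[Ea _ _] xia]; have [] := ladder_nxt nuchi Ea xia.
have [a [[[Ea Xia b'a] xia] /= al] _] := stationary_unbounded kreg lst bk.
exists l; last first.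
  rewrite -al.
  have [_ _ na _] := ladder_nxt nuchi Ea xia; have [ak _ _] := Ecof nuchi Ea.
  rewrite (lt_trans na ak) andbT; apply: (lt_le_trans bb'); apply: (le_trans b'a).
  have [Cn xin _ _] := ladder_nxt nuchi Ea xia.
  have [_ _ _ ->] // := ladder_nxt nuchi Ea Xia.
  exact: le_trans (ltW (xiP _ nuchi)) xin.
apply: (stationary_mono lst) => [e [[[Ee _ _] xie] ne] //|e [Ee _ _]].
by have [] := Ecof nuchi Ee.
Qed.

Lemma coding_on_stationary : exists xi h, [/\ xi < k, forall x : O, h x < theta &
  forall nu i, nu < chi -> i < theta ->
    stationary_in k [set a | [/\ E nu a, xi < a & h (nxt (C a) xi) = i]]].
Proof.
have [xi xik xiP] := ex_uniform_level.
have [h hth hP] := spread kreg chik thinf thk xiP.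
exists xi, h; split=> // nu i nuchi it; have [g gst hg] := hP nu i nuchi it.
apply: (stationary_mono gst) => [a [Ea xia ag]|a [Ea _ _]]; first by split=> //; rewrite ag.
by have [] := Ecof nuchi Ea.
Qed.

(** A successor gets its predecessor as its only rung and 0 gets none, so that walks are defined
    from every ordinal. *)
Definition ladder b :=
  if `[< is_limit b >] then C b else [set x | x < b /\ forall y, y < b -> y <= x].

Lemma ladder_unbounded a b : a < b -> b < k ->
  exists2 x, ladder b x & a <= x < b.
Proof.
move=> ab bk; rewrite /ladder; case: asboolP => [blim|nlim].
  have [_ Cunb _] := Cclub bk blim; have [x Cx /andP[ax xb]] := Cunb a ab.
  by exists x; rewrite // (ltW ax).
have [p pb pmax] := not_limit_pred (ex_intro _ a ab) nlim.
by exists p; rewrite // pmax.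
Qed.

Lemma ladder_acc a b : acc_point (ladder b) a -> is_limit b.
Proof.
move=> [[x xa] acc]; apply: contrapT => nlim; move: acc.
rewrite /ladder asboolF // => acc.
have [p [pb pmax] /andP[xp pa]] := acc x xa.
have [q [qb qmax] /andP[pq _]] := acc p pa.
by have := pmax q qb; rewrite leNgt pq.
Qed.

Lemma U_of_ladders : U k k theta chi.
Proof.
have [xi [h' [xik h'th h'st]]] := coding_on_stationary.
have [z zth] := infinite_setN0 (proj2 thinf).
pose h b := h' (nxt (ladder b) xi).
have [c [cth ch cn]] := walk_colouring ladder h z.
exists c; first by move=> x y _ _; apply: cth => // b; exact: h'th.
move=> nu nuchi _ A Asub Ak Atriv i ith.
have [j /andP[ij jth]] := proj2 (limit_infinite_cardinal thinf) i ith.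
have nuk := lt_trans nuchi chik.
have Sst := h'st nu j nuchi jth; set S := [set a | _] in Sst.
have SP dl : S dl -> [/\ dl < k, exists b, b < dl, nu < cf dl & h dl = j].
  move=> [Ed _ hd]; have [dk dlim ?] := Ecof nuchi Ed; split=> //.
    exact: (proj1 dlim).
  by rewrite /h /ladder asboolT.
(* By coherence [C b] and [C dl] agree below [dl], and the first element of [C dl] from [xi] on lies
   below [dl]; hence it is also the first one of [C b]. *)
have hacc dl b : S dl -> dl < b -> b < k -> acc_point (ladder b) dl -> h b = h dl.
  move=> [Ed xid _] db bk acc; have blim := ladder_acc acc.
  move: acc; have [_ dlim _] := Ecof nuchi Ed.
  rewrite /h /ladder !asboolT // => /(Ccoh nuchi Ed db bk blim) Cd.
  have [Cn xin nd nmin] := ladder_nxt nuchi Ed xid; congr h'.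
  move: (Cn); rewrite {1}Cd => -[Cbn _]; apply: nxt_eq => // y Cy xiy.
  have [yd|dy] := ltP y dl; last exact: le_trans (ltW nd) dy.
  by apply: nmin => //; rewrite Cd.
have kA : below k #<= A by have [] := proj1 (card_eqPle _ _) Ak.
have Ak' : A #<= below k by have [] := proj1 (card_eqPle _ _) Ak.
(* All members have the same size, so one empty member would leave [A] with at most one element. *)
have A0 s : A s -> s !=set0.
  move=> As; apply/set0P/negP => /eqP s0; apply: (proj2 (proj1 kreg)).
  apply: (card_le_finite kA); apply: (sub_finite_set _ (finite_set1 set0)) => t At.
  have [_ /card_esym snu] := Asub s As; have [_ tnu] := Asub t At.
  by have := card_eq_trans tnu snu; rewrite s0 card_eq0 => /eqP.
(* If every member met the ordinals up to [dl], picking such a point in each would, by disjointness,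
   inject [A] into some [m < k]. *)
have /(choice_on set0)[bb bbP] : forall dl, dl < k ->
    exists s, A s /\ forall x, s x -> dl < x.
  move=> dl dk; apply: contrapT => ns.
  have [m /andP[dm mk]] := proj2 klim dl dk.
  apply: (cardinal_not_le (proj1 (proj1 kreg)) mk); apply: (card_le_trans kA).
  have /(choice_on dl)[q qP] : forall s, A s -> exists x, s x /\ x <= dl.
    move=> s As; apply: contrapT => nx; apply: ns; exists s; split=> // x sx.
    by rewrite ltNge; apply/negP => xd; apply: nx; exists x.
  apply: (card_le_inj (f := q)) => [s /qP[_ qd]|s t As At e].
    exact: le_lt_trans qd dm.
  apply: Atriv => //; exists (q s); split; first exact: (proj1 (qP s As)).
  by rewrite e; exact: (proj1 (qP t At)).
have bbnu dl : dl < k -> bb dl #<= below nu /\ bb dl `<=` below k.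
  move=> /bbP[/Asub[? bnu] _]; split=> //.
  by have [] := proj1 (card_eqPle _ _) bnu.
have /(choice_on k)[sup supP] : forall dl, dl < k ->
    exists y, y < k /\ forall x, bb dl x -> x < y.
  move=> dl /bbnu[bnu bk].
  by have [y] := regular_bound_card wfO kreg (f := id) nuk bnu bk; exists y.
have /(choice_on k)[l lP] : forall dl, S dl -> exists l, l < dl /\
    forall b a, bb dl b -> l < a -> a < dl -> j <= c a b.
  move=> dl Sd; have [dk d0 nucf hd] := SP dl Sd; have [bnu bk] := bbnu dl dk.
  have /(choice_on k)[L LP] : forall b, bb dl b -> exists l, l < dl /\
      forall a, l < a -> a < dl -> j <= c a b.
    move=> b bb_b; have db := proj2 (bbP dl dk) b bb_b.
    have [l ld lh] := walk_low ch cn ladder_unbounded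
      (fun b => hacc dl b Sd) d0 (ltW db) (bk b bb_b).
    by exists l; split=> // a la ad; rewrite -hd; exact: lh.
  have [|m md mb] := cf_bound_card wfO d0 nucf bnu (f := L).
    by move=> b /LP[].
  exists m; split=> // b a bb_b ma ad; apply: (proj2 (LP b bb_b)) => //.
  exact: lt_trans (mb b bb_b) ma.
have [|l0 l0k Tst] := fodor wfO kreg (proj2 kru) Sst (f := l).
  by move=> a /lP[].
(* Closure under [sup] puts [bb a] entirely below [b] for [a < b] in [T]. Hence [bb] is injective on
   [T], and its values are ordered like their indices. *)
pose T := [set a | [/\ S a, l a = l0, l0 < a & forall x, x < a -> sup x < a]].
have Tunb : unbounded_in k T.
  move=> b bk; have mk : Order.max l0 b < k by rewrite gt_max l0k.
  have clubD := club_closure wfO kreg (proj2 kru) (fun x xk => proj1 (supP x xk)).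
  have [a [[Sa la] [[ak acl] /= ma]]] := proj2 Tst _ (club_tail clubD mk).
  by move: ma; rewrite gt_max => /andP[la' ba]; exists a; rewrite ?ba.
have Tk a : T a -> a < k by case=> /SP[].
have Tsep a b x : T a -> T b -> a < b -> bb a x -> x < b.
  move=> Ta [_ _ _ bcl] ab ax; apply: lt_trans (bcl a ab).
  by have [_] := supP a (Tk a Ta); apply.
exists (bb @` T).
  split; first by move=> _ [a /Tk/bbP[? _] <-].
  apply: Cantor_Bernstein.
    by apply: card_le_trans Ak'; apply: subset_card_le => _ [a /Tk/bbP[? _] <-].
  apply: (card_le_trans (unbounded_card wfO kreg Tunb)).
  apply: (card_le_inj (f := bb)) => [a Ta|a b Ta Tb e]; first by exists a.
  have [x ax] := A0 _ (proj1 (bbP a (Tk a Ta))).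
  have [ab|ba|//] := ltgtP a b.
    have := Tsep a b x Ta Tb ab ax; have := proj2 (bbP b (Tk b Tb)) x.
    by rewrite -e => /(_ ax) bx xb; have := lt_trans bx xb; rewrite ltxx.
  rewrite e in ax; have := Tsep b a x Tb Ta ba ax.
  have := proj2 (bbP a (Tk a Ta)) x; rewrite e => /(_ ax) bx xb.
  by have := lt_trans bx xb; rewrite ltxx.
move=> _ _ [a Ta <-] [b Tb <-] ne ltab.
have [x ax] := A0 _ (proj1 (bbP a (Tk a Ta))).
have [y by_] := A0 _ (proj1 (bbP b (Tk b Tb))).
have ab : a < b.
  have [//|ba|e] := ltgtP a b; last by case: ne; rewrite e.
  have := Tsep b a y Tb Ta ba by_; have := proj2 (bbP a (Tk a Ta)) x ax.
  have := ltab x y ax by_ => xy ax' ya.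
  by have := lt_trans (lt_trans ya ax') xy; rewrite ltxx.
have [|[x' ax' [y' by' <-]] _] :=
  @ordminP _ _ wfO i [set c x y | x in bb a & y in bb b].
  by exists (c x y), x => //; exists y.
(* The bound at [b] applies to [x'] because [l0 < a < x' < b]. *)
have [Sb lb l0b _] := Tb; have [_ lbP] := lP b Sb.
apply: (lt_le_trans ij); apply: lbP => //; last exact: Tsep Ta Tb ab ax'.
have [_ _ l0a _] := Ta; rewrite lb; apply: (lt_trans l0a).
exact: (proj2 (bbP a (Tk a Ta))).
Qed.

End Construction.
End Walks.

(** * Ladder systems from the hypotheses *)

Section Cases.
Context {d : Order.disp_t} {O : orderType d} (wfO : ord_wf O).
Implicit Types (a b g k l w x y z chi nu theta : O) (S D : set O).

(** If [cf a] had a last predecessor [p], the values of [f] below [p] would be bounded in [a], and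
    adding the single value [f p] would not make them cofinal in a limit. *)
Lemma limit_cf a : is_limit a -> is_limit (cf a).
Proof.
move=> [[b ba] alim]; have [f [fa fcof]] := cf_fun wfO a.
apply: contrapT => /not_limit_pred[|p pcf pmax].
  by have [x] := fcof b ba; exists x.
have [|m ma mb] := cf_bound wfO pcf (f := f).
  by move=> x xp; apply: fa; exact: lt_trans pcf.
have mx : Order.max m (f p) < a by rewrite gt_max ma fa.
have [c /andP[]] := alim _ mx; rewrite gt_max => /andP[mc pc] ca.
have [x xcf cx] := fcof c ca; have := pmax x xcf.
rewrite le_eqVlt => /orP[/eqP xp|/mb xm].
  by move: cx; rewrite xp leNgt pc.
by move: cx; rewrite leNgt (lt_trans xm mc).
Qed.

(* The strict suprema of the initial segments of a cofinal map [cf a -> a]. *)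
Lemma ex_club_small_cf a : is_limit a ->
  exists C, club_in a C /\ forall b, C b -> cf b < cf a.
Proof.
move=> alim; have [_ cflim] := limit_cf alim.
have [f [fa fcof]] := cf_fun wfO a.
have /(choice_on a)[F FP] : forall x, x < cf a -> exists z,
    [/\ z < a, forall y, y < x -> f y < z &
        forall z', (forall y, y < x -> f y < z') -> z <= z'].
  move=> x xcf; have [|z za zb] := cf_bound wfO xcf (f := f).
    by move=> y yx; apply: fa; exact: lt_trans xcf.
  have [m mb mmin] := ex_min wfO (X := [set z | forall y, y < x -> f y < z])
    (ex_intro _ z zb).
  by exists m; split=> //; apply: le_lt_trans za; exact: mmin.
have Fmono x y : x <= y -> y < cf a -> F x <= F y.
  move=> xy ycf; have [_ _] := FP x (le_lt_trans xy ycf); apply=> z zx.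
  by have [_ + _] := FP y ycf; apply; exact: lt_le_trans xy.
exists (F @` below (cf a)); split; first split=> [_ [x /FP[]] ? _ _ <- //|b ba|b ba].
- have [y ycf by_] := fcof b ba; have [x /andP[yx xcf]] := cflim y ycf.
  have [Fa Fub _] := FP x xcf; exists (F x); first by exists x.
  by rewrite Fa andbT; exact: le_lt_trans by_ (Fub y yx).
- move=> [_ bacc].
  have [y0 y0cf by0] := fcof b ba; have [x0 /andP[y0x0 x0cf]] := cflim y0 y0cf.
  have [_ x0ub _] := FP x0 x0cf.
  (* The least [x] with [b <= F x] gives [F x = b]: if [b <= f y] with [y < x], then [F y < b],
     while any later value of [F] exceeds [f y], so the image of [F] misses [(F y, b)]. *)
  have [x [xcf bF] xmin] := ex_min wfO (X := [set x | x < cf a /\ b <= F x])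
    (ex_intro _ x0 (conj x0cf (ltW (le_lt_trans by0 (x0ub _ y0x0))))).
  exists x => //; apply/eqP; rewrite eq_le bF andbT.
  have [_ _ Fmin] := FP x xcf; apply: Fmin => y yx.
  rewrite ltNge; apply/negP => bf.
  have ycf := lt_trans yx xcf.
  have Fyb : F y < b.
    by rewrite ltNge; apply/negP => bFy; have := xmin y (conj ycf bFy); rewrite leNgt yx.
  have [_ [y' y'cf <-] /andP[FF F'b]] := bacc _ Fyb.
  have [y'y|yy'] := leP y' y; first by have := Fmono _ _ y'y ycf; rewrite leNgt FF.
  have [_ ub _] := FP y' y'cf.
  by have := lt_trans (le_lt_trans bf (ub y yy')) F'b; rewrite ltxx.
(* The map [f] restricted to [x] is cofinal in [F x], so [cf (F x) <= x]. *)
- move=> _ [x xcf <-]; apply: le_lt_trans (xcf).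
  have [_ ub Fmin] := FP x xcf; apply: (cf_min wfO ub) => z zF.
  apply: contrapT => ny; suff: F x <= z by rewrite leNgt zF.
  apply: Fmin => y yx; rewrite ltNge; apply/negP => zf; apply: ny.
  by exists y.
Qed.

(** [E nu] consists of all limits of cofinality above [nu]. If a club [D] violated [Cthread], the
    ladders at the points of [D] in [E nu] would extend one another, and their union [T] would
    thread the square sequence. *)
Lemma U_of_square k chi theta : regular_uncountable k ->
  infinite_cardinal chi -> chi < k -> infinite_cardinal theta -> theta < k ->
  square k -> U k k theta chi.
Proof.
move=> kru chiinf chik thinf thk [C [Cclub Ccoh Cthr]].
pose E nu : set O := [set a | [/\ a < k, is_limit a & nu < cf a]].
apply: (@U_of_ladders _ _ wfO k chi theta C E) => //.
  by move=> nu a b _ [ak alim _] ab bk blim; exact: Ccoh.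
move=> nu D nuchi clubD; apply: contrapT => nD; apply: Cthr.
have accD a g : D a -> E nu a -> D g -> E nu g -> g < a -> acc_point (C a) g.
  by move=> Da Ea Dg Eg ga; apply: contrapT => nacc; apply: nD; exists a, g.
have DE b : b < k -> exists a, [/\ D a, E nu a & b < a].
  move=> bk; have [r [rreg nur rchi]] := regular_above wfO chiinf nuchi.
  have [a [Da ba] ra] := club_cof wfO (proj1 kru) rreg (le_lt_trans rchi chik)
    (club_tail clubD bk).
  exists a; split=> //; split; first by have [Dk _ _] := clubD; exact: Dk.
    by apply: infinite_cf_limit => //; exact: infinite_mono ra (proj2 (proj1 rreg)).
  exact: lt_le_trans nur ra.
pose T := [set x | exists a, [/\ D a, E nu a & C a x]].
have TE a : D a -> E nu a -> (T `&` below a)%classic = C a.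
  move=> Da Ea; have [ak alim _] := Ea; apply/seteqP; split=> x; last first.
    by have [Ca _ _] := Cclub a ak alim => Cx; split; [exists a|exact: Ca].
  case=> -[b [Db Eb Cx]] xa; have [bk blim _] := Eb.
  have [ab|ba|e] := ltgtP a b; last by rewrite e.
    by rewrite (Ccoh b a) //; exact: accD.
  by move: Cx; rewrite (Ccoh a b) //; [case|exact: accD].
have Tacc a b : D a -> E nu a -> b < a -> acc_point T b -> acc_point (C a) b.
  move=> Da Ea ba [b0 bT]; split=> // e /bT[x Tx exb]; exists x => //.
  by rewrite -TE //; split=> //; have /andP[_ xb] := exb; exact: lt_trans xb ba.
exists T; split; first split.
- by move=> x [a [_ [ak alim _] Cx]]; have [Ca _ _] := Cclub a ak alim;
    exact: lt_trans (Ca _ Cx) ak.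
- move=> b /DE[a [Da Ea ba]]; have [ak alim _] := Ea.
  have [_ Cunb _] := Cclub a ak alim; have [x Cx /andP[bx xa]] := Cunb b ba.
  by exists x; [exists a|rewrite bx (lt_trans xa ak)].
- move=> b /DE[a [Da Ea ba]] bacc; have [ak alim _] := Ea.
  have [_ _ Ccl] := Cclub a ak alim; exists a; split=> //.
  by apply: Ccl => //; exact: Tacc.
- move=> b /DE[a [Da Ea ba]] bacc; have [ak alim _] := Ea.
  rewrite (Ccoh a b) //; last exact: Tacc.
  rewrite -TE // -setIA; congr (_ `&` _); apply/seteqP.
  by split=> x; [move=> xb; split=> //; exact: lt_trans xb ba|case].
Qed.

(** With ladders disjoint from [S], no ladder accumulates at a point of [S]. So with [S] for every
    [E nu], coherence is vacuous, and any two points of [S] in a club witness [Cthread]. *)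
Lemma U_of_nonreflecting k chi theta S : regular_uncountable k ->
  infinite_cardinal chi -> chi < k -> infinite_cardinal theta -> theta < k ->
  S `<=` cof_ge k chi -> stationary_in k S -> nonreflecting k S ->
  U k k theta chi.
Proof.
move=> kru chiinf chik thinf thk Scof Sst Snr.
have /(choice_on set0)[C CP] : forall a, a < k /\ is_limit a ->
    (* For uncountable cofinality the ladder comes from non-reflection; for the other limits, from a
       club whose points have cofinality below [cf a], hence below [chi]. *)
    exists C, club_in a C /\ forall b, C b -> ~ S b.
  move=> a [ak alim]; have [aunc|acnt] := EM (uncountable_cf a).
    apply: contrapT => nC; apply: Snr; exists a; split=> //.
    split=> [x [] //|D clubD]; apply: contrapT => DS; apply: nC.
    exists D; split=> // b Db Sb; apply: DS; exists b; split=> //.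
    by split=> //; have [Da _ _] := clubD; exact: Da.
  have [D [clubD Dcf]] := ex_club_small_cf alim; exists D; split=> // b /Dcf ba Sb.
  apply: acnt; have [w wom wchi] := ex_omega wfO (proj2 chiinf).
  exists w => //; have [_ chib] := Scof b Sb.
  exact: le_lt_trans wchi (le_lt_trans chib ba).
have Sacc a b : S a -> a < b -> b < k -> is_limit b -> ~ acc_point (C b) a.
  move=> Sa ab bk blim acc; have [[_ _ Ccl] CS] := CP b (conj bk blim).
  by apply: (CS a) => //; exact: Ccl.
have SE nu a : nu < chi -> S a -> [/\ a < k, is_limit a & nu < cf a].
  move=> nuchi Sa; have [ak chia] := Scof a Sa; split=> //.
    by apply: infinite_cf_limit => //; exact: infinite_mono chia (proj2 chiinf).
  exact: lt_le_trans nuchi chia.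
apply: (@U_of_ladders _ _ wfO k chi theta C (fun=> S)) => //.
- by move=> a ak alim; have [] := CP a (conj ak alim).
- by move=> nu a b _ Sa ab bk blim /Sacc; case.
- move=> nu D nuchi clubD; have [g [Sg Dg]] := proj2 Sst _ clubD.
  have [gk _ _] := SE _ _ nuchi Sg.
  have [a [Sa [Da ga]]] := proj2 Sst _ (club_tail clubD gk).
  exists a, g; split=> //; have [ak alim _] := SE _ _ nuchi Sa.
  exact: Sacc.
Qed.

(** The set [cof_ge k l] does not reflect: each [a < k] has size at most [l], so [cf a <= l], and a
    limit [a] has a club of points of cofinality below [cf a]. *)
Lemma U_successor_of_regular theta l k : regular_cardinal theta ->
  regular_cardinal l -> theta <= l -> is_successor_cardinal l k ->
  U k k theta l.
Proof.
move=> threg lreg thl lk; have linf := proj2 (proj1 lreg).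
have [kcard lltk _] := lk; have kreg := successor_regular wfO linf lk.
have kru : regular_uncountable k.
  split=> // kcnt; apply: (cardinal_not_le kcard lltk).
  by apply: card_le_trans kcnt _; apply/infiniteP.
apply: (@U_of_nonreflecting _ _ _ (cof_ge k l)) => //.
- exact: (proj1 lreg).
- exact: (proj1 threg).
- exact: le_lt_trans thl lltk.
- split=> [a [] //|D clubD]; have [a Da la] := club_cof wfO kreg lreg lltk clubD.
  by exists a; split=> //; split=> //; have [Dk _ _] := clubD; exact: Dk.
- move=> [a [ak [w [winf _] wcf] [_ aS]]].
  have alim : is_limit a.
    by apply: infinite_cf_limit => //; exact: infinite_mono (ltW wcf) winf.
  have [C [clubC Ccf]] := ex_club_small_cf alim.
  have [b [[[_ lb] _] /Ccf ba]] := aS C clubC.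
  have := le_lt_trans lb ba; rewrite ltNge => /negP; apply.
  have [s sP] := card_leE_surj a (below_successor_le wfO lk ak).
  have [[c ca] _] := alim.
  apply: (@cf_min _ _ wfO _ _ (fun x => if s x < a then s x else c)) => [x _|y ya].
    by case: ifP.
  by have [x xl sx] := sP y ya; exists x => //; rewrite sx ya.
Qed.

End Cases.
Unset Implicit Arguments.

Theorem theoremA (d : Order.disp_t) (O : orderType d) (wfO : ord_wf O) :
  (forall kappa chi theta : O,
     regular_uncountable kappa ->
     infinite_cardinal chi -> chi < kappa ->
     infinite_cardinal theta -> theta < kappa ->
     square kappa \/
       (exists S : set O, [/\ S `<=` cof_ge kappa chi,
          stationary_in kappa S & nonreflecting kappa S]) ->
     U kappa kappa theta chi)
  /\
  (forall theta lambda lambda_plus : O,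
     regular_cardinal theta -> regular_cardinal lambda -> theta <= lambda ->
     is_successor_cardinal lambda lambda_plus ->
     U lambda_plus lambda_plus theta lambda).
Proof.
split=> [k chi theta kru chiinf chik thinf thk|theta l k]; last exact: U_successor_of_regular.
case=> [|[S [Scof Sst Snr]]]; first exact: U_of_square.
exact: U_of_nonreflecting Scof Sst Snr.
Qed.
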